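(* Let $G$ be a locally nilpotent group having a nontrivial hypercentral subgroup $H$ which is a hereditary Aut-basis of $G$. Then $G$ is hypercentral of the same hypercentral length as $H$. In particular, if $H$ is nilpotent then also $G$ is nilpotent.
   Context: A subset $X$ of a group $G$ is an Aut-basis of $G$ if any two automorphisms of $G$ having the same restriction to $X$ are equal; it is a hereditary Aut-basis of $G$ if it is an Aut-basis of every subgroup of $G$ containing it. A group is locally nilpotent if all its finitely generated subgroups are nilpotent. A group is hypercentral if its transfinite upper central series $(Z_\alpha)$ reaches the whole group; its hypercentral length is the least ordinal $\alpha$ such that $Z_\alpha$ is the whole group. *)

(* Defs.v *)
From HB Require Import structures.
From mathcomp Require Import all_boot.
From mathcomp Require Import boolp classical_sets functions cardinality.

Set Implicit Arguments.
Unset Strict Implicit.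
Unset Printing Implicit Defensive.

Local Open Scope classical_set_scope.
Local Open Scope group_scope.

(* Ordinals are represented by well-founded trees, and equality of ordinals by
   [ord_le] in both directions: classically, [ord_le] is a total preorder which
   is well founded, and [OSup f] is the supremum of an arbitrary (possibly
   empty or non-monotone) family. *)
Inductive ordinal_tree : Type :=
| OZero
| OSucc of ordinal_tree
| OSup (T : Type) of (T -> ordinal_tree).

(* The inner fixpoint is [a' < c], i.e., [ord_le (OSucc a') c]. *)
Fixpoint ord_le (a b : ordinal_tree) {struct a} : Prop :=
  match a with
  | OZero => True
  | OSucc a' =>
      (fix a'_lt (c : ordinal_tree) : Prop :=
         match c with
         | OZero => False
         | OSucc c' => ord_le a' c'
         | OSup T g => exists t : T, a'_lt (g t)
         end) b
  | OSup T f => forall t : T, ord_le (f t) b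
  end.

Section Groups.
Variable G : groupType.
Implicit Types (X K L N : set G).

Definition subgroup K : Prop := group_closed (mem K).

Definition gen X : set G := smallest subgroup X.

Definition finitely_generated K : Prop :=
  exists2 X, finite_set X & K = gen X.

(* An automorphism of the subgroup K is represented by a function on G, of
   which only the values on K matter. *)
Definition automorphism K (f : G -> G) : Prop :=
  set_bij K K f /\ {in K &, {morph f : x y / x * y}}.

Definition aut_basis X K : Prop :=
  X `<=` K /\
  forall f g, automorphism K f -> automorphism K g ->
    {in X, f =1 g} -> {in K, f =1 g}.

Definition hereditary_aut_basis X K : Prop :=
  X `<=` K /\
  forall L, subgroup L -> X `<=` L -> L `<=` K -> aut_basis X L.

(* When N is a normal subgroup of K, this is the preimage in K of the centre
   of K / N. *)
Definition next_center K N : set G :=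
  [set x | K x /\ forall y, K y -> N [~ x, y]].

(* Adjoining 1 matters only for the supremum of an empty family; at a limit
   this is the union of the earlier terms. *)
Fixpoint upper_central K (a : ordinal_tree) : set G :=
  match a with
  | OZero => [set 1]
  | OSucc b => next_center K (upper_central K b)
  | OSup T f => [set 1] `|` \bigcup_(t in [set: T]) upper_central K (f t)
  end.

Definition hypercentral K : Prop := exists a, upper_central K a = K.

Definition hypercentral_length K (a : ordinal_tree) : Prop :=
  upper_central K a = K /\
  forall b, upper_central K b = K -> ord_le a b.

Definition nilpotent_subgroup K : Prop :=
  exists n : nat, iter n (next_center K) [set 1] = K.

Definition locally_nilpotent K : Prop :=
  forall L, subgroup L -> L `<=` K -> finitely_generated L ->
    nilpotent_subgroup L.

End Groups.

(* Main.v *)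
Require Import Defs.
From HB Require Import structures.
From mathcomp Require Import all_boot.
From mathcomp Require Import boolp classical_sets functions cardinality.

Set Implicit Arguments.
Unset Strict Implicit.
Unset Printing Implicit Defensive.

Local Open Scope classical_set_scope.
Local Open Scope group_scope.

(** Write C for the centre of G, and call a positive k torsion-free when C has
    no nontrivial element of order dividing k.

    An inner automorphism by an element centralising H fixes H pointwise, so H
    being an Aut-basis of G gives that the centraliser of H in G is C. It is
    harmless to replace H by HC: as H is nontrivial, so is C, and a term of
    the upper central series of HC is either trivial or contains C, whence
    every ordinal at which the series of H reaches H is one at which the
    series of HC reaches HC. So let H contain C.

    - Every g in G has a torsion-free power in H ([power_in_basis]). Let K be
      generated by H and g, and D = HK'. The group K / D is cyclic, generated
      by the class of g; if no torsion-free power of g were in D there would be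
      a nontrivial homomorphism phi from K to C killing D, and x |-> x phi(x)
      would be a nontrivial automorphism of K fixing H ([cyclic_quotient]).
      Hence g^k lies in HK' for some torsion-free k. This uses only finitely
      many elements of H, so it happens inside a finitely generated, hence
      nilpotent, subgroup P; and in a nilpotent group P a subgroup U whose
      product UP' contains suitable powers of generators of P contains
      suitable powers of all elements of P ([nilpotent_isolator]).

    - A subgroup N normalised by H and meeting H trivially is centralised by H
      ([complement_centralised]): by induction on a, if x lies in the a-th
      upper centre of H then hn |-> h^x n is an automorphism of HN which agrees
      on H with conjugation by x, hence on N as well. If t^k = 1 with k
      torsion-free, the subgroup generated by the conjugates of t under H is
      such an N, so it lies in C, and t = 1 ([torsion_free]).

    - In a locally nilpotent group, if v commutes with u^k and there is no
      k-torsion then v commutes with u; the same holds modulo a normal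
      subgroup ([commg_root]). So the quotients of G by the terms Z_a(G) of its
      upper central series have no k-torsion either, and then Z_a(H) is
      contained in Z_a(G) for all a: a commutator [x, g] with x in
      Z_{a+1}(H) lies in Z_a(G) because [x, g^k] does, for the k such that g^k
      is in H.

    Finally Z_a(H) = H implies that Z_a(G) contains H, hence every g, as it
    contains a torsion-free power of g. Conversely Z_a(G) = G implies
    Z_a(H) = H by restriction. So the two series become stationary at the full
    group at exactly the same ordinals. *)

(** * The ordering of ordinal trees *)

Lemma ord_le_sup a T (g : T -> ordinal_tree) t :
  ord_le a (g t) -> ord_le a (OSup g).
Proof.
elim: a => [//|a _ le_at|S f IH le_ft s]; first by exists t.
exact/IH/(le_ft s).
Qed.

Lemma ord_le_refl a : ord_le a a.
Proof. by elim: a => // T f IH t; apply: ord_le_sup (IH t). Qed.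

(** The successor case needs that [OSucc a <= b] implies [a <= b], which in turn
    needs the present statement for [a]; this is why the second claim is proved
    here by an inner induction on [b]. *)
Lemma ord_leS a b : ord_le a b -> ord_le a (OSucc b).
Proof.
elim: a b => [//|a IH|T f IH] b; last by move=> le_fb t; apply/IH/(le_fb t).
elim: b => [//|b _ /IH //|T g IHg [t lt_at]].
exact/ord_le_sup/(IHg t lt_at).
Qed.

Lemma ord_ltW a b : ord_le (OSucc a) b -> ord_le a b.
Proof.
elim: b => [//|b _ /ord_leS //|T g IHg [t lt_at]].
exact/ord_le_sup/(IHg t lt_at).
Qed.

Lemma ord_le_trans b a c : ord_le a b -> ord_le b c -> ord_le a c.
Proof.
elim: a b c => [//|a IH|T f IH] b c; last first.
  by move=> le_fb le_bc t; apply: (IH t b) => //; apply: le_fb.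
elim: b => [//|b _|T g IHg [t lt_at] le_gc]; last exact: IHg lt_at (le_gc t).
move=> le_ab; elim: c => [//|c _ le_bc|T g IHg [t lt_bt]].
  exact: IH le_ab le_bc.
by exists t; apply: IHg.
Qed.

Lemma ord_le_total a b : ord_le a b \/ ord_le (OSucc b) a.
Proof.
elim: a b => [|a IHa|T f IH] b; first by left.
  elim: b => [|b _|T g IHg]; [by right | exact: IHa |].
  have [[t lt_at]|no_t] := pselect (exists t, ord_le (OSucc a) (g t)).
    by left; exists t.
  by right=> t; case: (IHg t) => // lt_at; case: no_t; exists t.
have [[t lt_bt]|no_t] := pselect (exists t, ord_le (OSucc b) (f t)).
  by right; exists t.
by left=> t; case: (IH t b) => // lt_bt; case: no_t; exists t.
Qed.

Lemma ord_lt_wf : well_founded (fun a b => ord_le (OSucc a) b).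
Proof.
move=> b; have: ord_le b b by exact: ord_le_refl.
elim: b {1 3}b => [|b IH|T f IH] a le_ab; constructor=> c lt_ca;
  have lt_cb := ord_le_trans lt_ca le_ab.
- by [].
- exact: IH lt_cb.
- by case: lt_cb => t /ord_ltW; apply: IH.
Qed.

(** The source of hypercentral lengths: one only has to know at which ordinals
    the series reaches the top. *)
Lemma ord_minimum (P : ordinal_tree -> Prop) a : P a ->
  exists m, P m /\ forall b, P b -> ord_le m b.
Proof.
elim/(well_founded_ind ord_lt_wf): a => a IH Pa.
have [[b [Pb lt_ba]]|no_b] := pselect (exists b, P b /\ ord_le (OSucc b) a).
  exact: IH lt_ba Pb.
exists a; split=> // b Pb; case: (ord_le_total a b) => // lt_ba.
by case: no_b; exists b.
Qed.

(** * Subgroups of an abstract group *)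

Section Groups.
Variable G : groupType.
Implicit Types (x y z u v w g : G) (X K L M N P Q U : set G).

Lemma subgroupP K :
  subgroup K <-> K 1 /\ forall x y, K x -> K y -> K (x * y^-1).
Proof.
split=> [[K1 KV]|[K1 KV]]; split.
- by rewrite inE in K1.
- move=> x y Kx Ky; have := KV x y; rewrite !inE; exact.
- by rewrite inE.
- by move=> x y; rewrite !inE; apply: KV.
Qed.

Section Subgroup.
Variable K : set G.
Hypothesis sgK : subgroup K.

Lemma subgroup1 : K 1. Proof. by case/subgroupP: sgK. Qed.

Lemma subgroupV x : K x -> K x^-1.
Proof. by case/subgroupP: sgK => K1 KV /(KV 1 _ K1); rewrite mul1g. Qed.

Lemma subgroupM x y : K x -> K y -> K (x * y).
Proof.
case/subgroupP: sgK => _ KV Kx /subgroupV Ky.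
by have := KV _ _ Kx Ky; rewrite invgK.
Qed.

Lemma subgroupX n x : K x -> K (x ^+ n).
Proof.
by move=> Kx; elim: n => [|n IH]; [apply: subgroup1|rewrite expgS; apply: subgroupM].
Qed.

Lemma subgroupJ x y : K x -> K y -> K (x ^ y).
Proof.
move=> Kx Ky; rewrite /conjg.
by apply: subgroupM; [apply: subgroupV|apply: subgroupM].
Qed.

Lemma subgroupR x y : K x -> K y -> K [~ x, y].
Proof.
move=> Kx Ky; rewrite /commg.
by apply: subgroupM; [apply: subgroupV|apply: subgroupJ].
Qed.

Lemma subgroup_mulr x y : K x -> K (x * y) -> K y.
Proof.
by move=> Kx Kxy; rewrite -(mulKg x y); apply: subgroupM => //; apply: subgroupV.
Qed.

Lemma subgroup_mull x y : K y -> K (x * y) -> K x.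
Proof.
by move=> Ky Kxy; rewrite -(mulgK y x); apply: subgroupM => //; apply: subgroupV.
Qed.

End Subgroup.

Lemma subgroup_of K : K 1 -> (forall x y, K x -> K y -> K (x * y)) ->
  (forall x, K x -> K x^-1) -> subgroup K.
Proof.
by move=> K1 KM KV; apply/subgroupP; split=> // x y Kx Ky; apply/KM/KV.
Qed.

Lemma subgroupT : subgroup [set: G].
Proof. by apply/subgroupP; split. Qed.

Lemma subgroup_set1 : subgroup [set 1 : G].
Proof. by apply/subgroupP; split=> // x y -> ->; rewrite mulgV. Qed.

Lemma subgroup_setI K L : subgroup K -> subgroup L -> subgroup (K `&` L).
Proof.
move=> sgK sgL; apply: subgroup_of.
- by split; apply: subgroup1.
- by move=> x y [Kx Lx] [Ky Ly]; split; apply: subgroupM.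
- by move=> x [Kx Lx]; split; apply: subgroupV.
Qed.

Lemma subgroup_gen X : subgroup (gen X).
Proof.
apply: subgroup_of.
- by move=> K [sgK _]; apply: subgroup1.
- by move=> x y gx gy K sXK; apply: (subgroupM sXK.1); [apply: gx|apply: gy].
- by move=> x gx K sXK; apply: (subgroupV sXK.1); apply: gx.
Qed.

Lemma sub_gen X : X `<=` gen X.
Proof. exact: sub_gen_smallest. Qed.

Lemma gen_sub X K : subgroup K -> X `<=` K -> gen X `<=` K.
Proof. exact: smallest_sub. Qed.

Lemma gen_mono X K : X `<=` K -> gen X `<=` gen K.
Proof.
by move=> sXK; apply: gen_sub; [apply: subgroup_gen|apply: subset_trans (@sub_gen K)].
Qed.

Definition normalises Q M := forall q m, Q q -> M m -> M (m ^ q).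

Lemma gen_normalises Q X : subgroup Q -> normalises Q X -> normalises Q (gen X).
Proof.
move=> sgQ nX q m Qq.
suff sub : gen X `<=` [set y | gen X (y ^ q)] by move=> /sub.
have sg := subgroup_gen X.
apply: gen_sub => [|x Xx]; last by apply: sub_gen; apply: nX.
apply: subgroup_of => [|x y /= gx gy|x /= gx].
- by rewrite /= conj1g; apply: (subgroup1 sg).
- by rewrite /= conjMg; apply: (subgroupM sg).
- by rewrite /= conjVg; apply: (subgroupV sg).
Qed.

(** The reduction of a membership in a generated subgroup to finitely many
    generators, for any construction [Phi] monotone in the generators. *)
Lemma subgroup_directed_union X (Phi : set G -> set G) :
  (forall F, subgroup (Phi F)) ->
  (forall E F, E `<=` F -> Phi E `<=` Phi F) ->
  subgroup [set x | exists F, [/\ finite_set F, F `<=` X & Phi F x]].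
Proof.
move=> sgPhi mono.
apply: subgroup_of => [|a b [A [fA sA Pa]] [B [fB sB Pb]]|a [A [fA sA Pa]]].
- exists set0; split; [exact: finite_set0 | by [] |].
  exact: (subgroup1 (sgPhi _)).
- exists (A `|` B); split; first by rewrite finite_setU.
    by move=> y [/sA|/sB].
  by apply: (subgroupM (sgPhi _)); [apply: mono Pa|apply: mono Pb]; [left|right].
- by exists A; split=> //; apply: (subgroupV (sgPhi _)).
Qed.

Lemma gen_finite X x : gen X x ->
  exists F, [/\ finite_set F, F `<=` X & gen F x].
Proof.
apply: (gen_sub (subgroup_directed_union _ subgroup_gen gen_mono)) => y Xy.
by exists [set y]; split; [exact: finite_set1 | move=> _ -> | exact: sub_gen].
Qed.

Lemma commgMr v x y : [~ v, x * y] = [~ v, y] * [~ v, x] ^ y.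
Proof. by rewrite /commg /conjg !gnorm. Qed.

Lemma commgMl v w x : [~ v * w, x] = [~ v, x] ^ w * [~ w, x].
Proof. by rewrite /commg /conjg !gnorm. Qed.

Lemma commgVr v x : [~ v, x^-1] = ([~ v, x]^-1) ^ x^-1.
Proof. by rewrite /commg /conjg !gnorm. Qed.

Lemma commgVl v x : [~ v^-1, x] = ([~ v, x]^-1) ^ v^-1.
Proof. by rewrite /commg /conjg !gnorm. Qed.

Lemma conjg_mulR x y : x ^ y = x * [~ x, y].
Proof. by rewrite /commg mulVKg. Qed.

Lemma subgroup_commC K x y : subgroup K -> K [~ x, y] -> K [~ y, x].
Proof. by move=> sgK Kxy; rewrite -invgR; apply: subgroupV. Qed.

(** The product set UM, in the form that says that [x] is congruent to an
    element of U modulo M. *)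
Definition mulset U M : set G := [set x | exists2 u, U u & M (u^-1 * x)].

Lemma mem_mulset U M u m : U u -> M m -> mulset U M (u * m).
Proof. by move=> Uu Mm; exists u; rewrite ?mulKg. Qed.

Lemma mulset_subl U M : subgroup M -> U `<=` mulset U M.
Proof.
by move=> sgM u Uu; exists u => //; rewrite mulVg; apply: (subgroup1 sgM).
Qed.

Lemma mulset_subr U M : subgroup U -> M `<=` mulset U M.
Proof.
by move=> sgU m Mm; exists 1; [apply: subgroup1|rewrite invg1 mul1g].
Qed.

Lemma mulset_sub U M K : subgroup K -> U `<=` K -> M `<=` K -> mulset U M `<=` K.
Proof.
move=> sgK sUK sMK x [u /sUK Ku /sMK Kux].
by rewrite -(mulVKg u x); apply: subgroupM.
Qed.

Lemma subgroup_mulset U M : subgroup U -> subgroup M -> normalises U M ->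
  subgroup (mulset U M).
Proof.
move=> sgU sgM nUM.
apply: subgroup_of => [|x y [u Uu Mux] [v Uv Mvy]|x [u Uu Mux]].
- by apply: mulset_subl => //; apply: (subgroup1 sgU).
- exists (u * v); first exact: (subgroupM sgU).
  rewrite (_ : _ * _ = (u^-1 * x) ^ v * (v^-1 * y)); last by rewrite /conjg !gnorm.
  by apply: (subgroupM sgM) => //; apply: nUM.
- exists u^-1; first exact: (subgroupV sgU).
  rewrite (_ : _ * _ = (u^-1 * x)^-1 ^ u^-1); last by rewrite /conjg !gnorm.
  by apply: nUM; [apply: (subgroupV sgU)|apply: (subgroupV sgM)].
Qed.

(** * Commutator calculus modulo a normalised subgroup *)

(** These are the identities of a group Q / M, written in Q. *)
Section Modulo.
Variables Q M : set G.
Hypotheses (sgQ : subgroup Q) (sgM : subgroup M) (nQM : normalises Q M).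

Lemma centraliser_mod v : subgroup [set x | Q x /\ M [~ v, x]].
Proof.
apply: subgroup_of => [|x y [Qx Mx] [Qy My]|x [Qx Mx]].
- by split; [apply: subgroup1|rewrite commg1; apply: subgroup1].
- split; first exact: subgroupM.
  by rewrite commgMr; apply: subgroupM => //; apply: nQM.
- split; first exact: subgroupV.
  by rewrite commgVr; apply: nQM; apply: subgroupV.
Qed.

Lemma commg_modXr v x n : Q x -> M [~ v, x] -> M [~ v, x ^+ n].
Proof.
by move=> Qx Mvx; have [] := subgroupX (centraliser_mod v) n (conj Qx Mvx).
Qed.

(** In Q / M the hypothesis says that [c = [~ v, x]] commutes with [x], and then
    [v, x^n] = c^n. *)
Lemma mod_commgXr v x n : Q v -> Q x -> M [~ [~ v, x], x] ->
  M (([~ v, x] ^+ n)^-1 * [~ v, x ^+ n]).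
Proof.
move=> Qv Qx Mc; set c := [~ v, x] in Mc *.
have Qc : Q c by apply: subgroupR.
elim: n => [|n IH]; first by rewrite commg1 mulg1 invg1; apply: subgroup1.
set a := _ * _ in IH.
rewrite [X in [~ _, X]]expgS commgMr -/c [c ^ _]conjg_mulR expgSr.
rewrite (_ : _ * _ = a ^ c * [~ c, x ^+ n]); last first.
  by rewrite /a /conjg !gnorm.
by apply: subgroupM => //; [apply: nQM|apply: commg_modXr].
Qed.

Lemma mod_commgXl v x n : Q v -> Q x -> M [~ [~ v, x], v] ->
  M (([~ v, x] ^+ n)^-1 * [~ v ^+ n, x]).
Proof.
move=> Qv Qx Mc.
have Mc' : M [~ [~ x, v], v].
  rewrite -(invgR v x) commgVl; apply: nQM; last exact: subgroupV.
  by apply: subgroupV => //; apply: subgroupR.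
have := mod_commgXr n Qx Qv Mc'.
rewrite -(invgR x v) -(invgR x (v ^+ n)) expVgn invgK => Ma.
have Qy : Q [~ x, v ^+ n]^-1.
  by apply: subgroupV => //; apply: subgroupR => //; apply: subgroupX.
have := nQM Qy (subgroupV sgM Ma); rewrite /conjg !gnorm; exact.
Qed.

Lemma mod_expgMn x y n : Q x -> Q y -> M [~ y, x] ->
  M ((x ^+ n * y ^+ n)^-1 * (x * y) ^+ n).
Proof.
move=> Qx Qy Myx.
have Mxy : M [~ x, y] by apply: subgroup_commC.
elim: n => [|n IH]; first by rewrite !mulg1 invg1; apply: subgroup1.
set e := _ * _ in IH.
rewrite (_ : _ * _ = ([~ y ^+ n, x] * e ^ x) ^ y); last first.
  by rewrite /e !expgSr /commg /conjg !gnorm.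
apply: nQM => //; apply: subgroupM => //; last exact: nQM.
by apply: subgroup_commC => //; apply: commg_modXr.
Qed.

End Modulo.

(** * The lower central series *)

Section LowerCentral.
Variable P : set G.
Hypothesis sgP : subgroup P.

Fixpoint lower_central n : set G :=
  if n is m.+1 then
    gen [set z | exists v x, [/\ lower_central m v, P x & z = [~ v, x]]]
  else P.

Lemma subgroup_lower_central n : subgroup (lower_central n).
Proof. by case: n => [|n]; [exact: sgP|exact: subgroup_gen]. Qed.

Lemma lower_centralR n v x :
  lower_central n v -> P x -> lower_central n.+1 [~ v, x].
Proof. by move=> Lv Px; apply: sub_gen; exists v, x. Qed.

Lemma normalises_lower_central n : normalises P (lower_central n).
Proof.
elim: n => [|n IH]; first by move=> q m Pq Pm; apply: subgroupJ.
apply: gen_normalises => // q _ Pq [v [x [Lv Px ->]]].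
exists (v ^ q), (x ^ q); split; [exact: IH | exact: subgroupJ | exact: conjRg].
Qed.

Lemma lower_centralS n : lower_central n.+1 `<=` lower_central n.
Proof.
have sgL := subgroup_lower_central n.
apply: gen_sub => // _ [v [x [Lv Px ->]]]; rewrite /commg.
by apply: subgroupM => //; [apply: subgroupV|apply: normalises_lower_central].
Qed.

Lemma lower_central_sub n : lower_central n `<=` P.
Proof. by elim: n => [//|n IH x /lower_centralS /IH]. Qed.

End LowerCentral.

Lemma lower_central_mono P Q n :
  P `<=` Q -> lower_central P n `<=` lower_central Q n.
Proof.
move=> sPQ; elim: n => [//|n IH]; apply: gen_mono => _ [v [x [Lv Px ->]]].
by exists v, x; split; [apply: IH|apply: sPQ|].
Qed.

Lemma derived_finite X w : lower_central (gen X) 1 w ->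
  exists F, [/\ finite_set F, F `<=` X & lower_central (gen F) 1 w].
Proof.
suff sub : lower_central (gen X) 1 `<=` [set x | exists F,
    [/\ finite_set F, F `<=` X & lower_central (gen F) 1 x]] by move=> /sub.
apply: gen_sub.
  apply: (@subgroup_directed_union X (fun F => lower_central (gen F) 1)).
    by move=> F; apply: subgroup_lower_central (subgroup_gen F) _.
  by move=> E F sEF; apply: lower_central_mono (gen_mono sEF).
move=> _ [v [x [/gen_finite[E [fE sE gE]] /gen_finite[F [fF sF gF]] ->]]].
exists (E `|` F); split; first by rewrite finite_setU.
  by move=> y [/sE|/sF].
by apply: lower_centralR; [apply: gen_mono gE|apply: gen_mono gF]; [left|right].
Qed.

Lemma subgroup_next_center K N : subgroup K -> subgroup N -> normalises K N ->
  subgroup (next_center K N).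
Proof.
move=> sgK sgN nKN; apply: subgroup_of => [|x y [Kx Nx] [Ky Ny]|x [Kx Nx]].
- by split; [apply: subgroup1|move=> y _; rewrite comm1g; apply: subgroup1].
- split; first exact: subgroupM.
  move=> z Kz; rewrite commgMl.
  by apply: subgroupM => //; [apply: nKN => //; apply: Nx|apply: Ny].
- split; first exact: subgroupV.
  move=> z Kz; rewrite commgVl; apply: nKN; first exact: subgroupV.
  by apply: subgroupV => //; apply: Nx.
Qed.

Lemma normalises_next_center K N : subgroup K -> normalises K N ->
  normalises K (next_center K N).
Proof.
move=> sgK nKN q x Kq [Kx Nx]; split; first exact: subgroupJ.
move=> y Ky; rewrite -(conjgKV q y) -conjRg; apply: nKN => //; apply: Nx.
by apply: subgroupJ => //; apply: subgroupV.
Qed.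

Lemma iter_next_center K n : subgroup K ->
  let Z := iter n (next_center K) [set 1] in subgroup Z /\ normalises K Z.
Proof.
move=> sgK; elim: n => [|n [sgZ nZ]] /=.
  by split; [apply: subgroup_set1|move=> q m _ ->; rewrite /= conj1g].
by split; [apply: subgroup_next_center|apply: normalises_next_center].
Qed.

(** The lower central series descends at least as fast as the upper central
    series, read downwards from P. *)
Lemma lower_central_nilpotent P : subgroup P -> nilpotent_subgroup P ->
  exists c, lower_central P c `<=` [set 1].
Proof.
move=> sgP [c defP]; exists c.
suff sub i : lower_central P i `<=` iter (c - i) (next_center P) [set 1].
  by have := sub c; rewrite subnn.
elim: i => [|i IH]; first by rewrite subn0 defP.
have [sgZ _] := iter_next_center (c - i.+1) sgP.
apply: gen_sub => // _ [v [x [/IH Zv Px ->]]].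
move: Zv; rewrite subnS; case: (c - i) => [/= ->|k [_]] /=; last exact.
by rewrite comm1g.
Qed.

Lemma nilpotent_commg P u v : nilpotent_subgroup P -> P u -> P v ->
  exists c, iter c (fun w => [~ w, u]) v = 1.
Proof.
move=> [c defP] Pu; rewrite -{1}defP => Zv; exists c.
elim: c v Zv {defP} => [//|c IH] v [_ Zv].
by rewrite iterSr; apply: IH; apply: Zv.
Qed.

(** * Isolators in nilpotent groups *)

(** The predicate [good] stands for the set of pi-numbers for a set pi of primes,
    so that [isolator A W] is the pi-isolator of W in A. *)
Section Isolator.
Variable good : nat -> Prop.
Hypotheses (good1 : good 1) (goodM : forall m n, good m -> good n -> good (m * n)%N).

Definition isolator A W : set G :=
  [set x | A x /\ exists2 m, good m & W (x ^+ m)].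

(** The hypotheses make A / W an abelian group, of which this is the
    pi-torsion subgroup. *)
Lemma subgroup_isolator A W : subgroup A -> subgroup W -> W `<=` A ->
  (forall x y, A x -> A y -> W [~ x, y]) -> subgroup (isolator A W).
Proof.
move=> sgA sgW sWA abA.
have nAW : normalises A W.
  move=> q w Aq Ww; rewrite conjg_mulR; apply: subgroupM => //.
  by apply: abA => //; apply: sWA.
apply: subgroup_of => [|x y [Ax [m gm Wx]] [Ay [n gn Wy]]|x [Ax [m gm Wx]]].
- by split; [apply: subgroup1|exists 1%N; rewrite ?expg1n //; apply: (subgroup1 sgW)].
- split; first exact: subgroupM.
  exists (m * n)%N; first exact: goodM.
  have := mod_expgMn sgA sgW nAW (m * n) Ax Ay (abA y x Ay Ax).
  apply: subgroup_mulr => //; apply: subgroupV => //; apply: subgroupM => //.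
    by rewrite expgnA; apply: subgroupX.
  by rewrite mulnC expgnA; apply: subgroupX.
- split; first exact: subgroupV.
  by exists m => //; rewrite expVgn; apply: subgroupV.
Qed.

Section Nilpotent.
Variables P U : set G.
Hypotheses (sgP : subgroup P) (sgU : subgroup U) (sUP : U `<=` P).
Let L := lower_central P.
Let sgL n : subgroup (L n) := subgroup_lower_central sgP n.
Let nL n : normalises P (L n) := normalises_lower_central sgP (n := n).
Let LS n : L n.+1 `<=` L n := lower_centralS sgP (n := n).
Let LP n : L n `<=` P := lower_central_sub sgP (n := n).
Let LR n v x : L n v -> P x -> L n.+1 [~ v, x] := @lower_centralR P n v x.

(** The part of the n-th lower central factor that is covered by U. *)
Let W n : set G := L n `&` mulset U (L n.+1).

Let LW n : L n.+1 `<=` W n.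
Proof.
by move=> x Lx; split; [exact: LS|exact: mulset_subr].
Qed.

Let sgW n : subgroup (W n).
Proof.
apply: subgroup_setI => //; apply: subgroup_mulset => // q x /sUP Pq.
exact: nL.
Qed.

Let I n := isolator (L n) (W n).

Let sgI n : subgroup (I n).
Proof.
apply: (subgroup_isolator (sgL n) (sgW n)) => [x []//|x y Lx Ly].
by apply: LW; apply: LR => //; apply: LP Ly.
Qed.

Let WI n : W n `<=` I n.
Proof. by move=> x Wx; split; [case: Wx|exists 1%N]. Qed.

Let nI n : normalises P (I n).
Proof.
move=> q x Pq Ix; rewrite conjg_mulR; apply: subgroupM => //.
by apply: WI; apply: LW; apply: LR => //; case: Ix.
Qed.

(** For fixed [v], commutation with [v] is a homomorphism from P to the abelian
    factor [L n.+1 / L n.+2], so it kills commutators. *)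
Let comm_derived n v x : L n v -> L 1 x -> L n.+2 [~ v, x].
Proof.
move=> Lv; suff sub : L 1 `<=` [set x | P x /\ L n.+2 [~ v, x]] by move=> /sub[].
apply: gen_sub => [|_ [a [b [Pa Pb ->]]]]; first exact: centraliser_mod.
split; first exact: subgroupR.
set M := L n.+2; have sgM : subgroup M := sgL n.+2.
have LA c : P c -> L n.+1 [~ v, c] by move=> Pc; apply: LR.
set p := [~ v, b]; set q := [~ v, a]; set w := [~ a, b].
have Pw : P w by apply: subgroupR.
have Lp : L n.+1 p by apply: LA.
have Lq : L n.+1 q by apply: LA.
have Lr : L n.+1 (q * p ^ a) by apply: (subgroupM (sgL n.+1)) => //; apply: nL.
(* Compare v^(ab) = v^(ba w), computed as v (p q^b) and as (v r)^w, with
   r = q p^a; all the correcting commutators lie in M. *)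
have -> : [~ v, w] =
  ([~ q, b] * [~ q * p ^ a, w]^-1 * [~ p, a]^-1) ^ (p * q)^-1 * [~ p^-1, q^-1].
  by rewrite /p /q /w /commg /conjg !gnorm.
have LM c d : L n.+1 c -> P d -> M [~ c, d] by move=> Lc Pd; apply: LR.
apply: (subgroupM sgM); last first.
  apply: LM; first exact: (subgroupV (sgL n.+1)).
  by apply: subgroupV => //; apply: LP Lq.
apply: nL.
  by apply: subgroupV => //; apply: subgroupM => //; [apply: LP Lp|apply: LP Lq].
apply: (subgroupM sgM); last by apply: (subgroupV sgM); apply: LM.
by apply: (subgroupM sgM); [|apply: (subgroupV sgM)]; apply: LM.
Qed.

Variable X : set G.
Hypotheses (genX : P = gen X)
  (goodX : X `<=` isolator P (mulset U (L 1))).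

(** The factor [L n / L n.+1] is generated by commutators which are bilinear, so
    if powers of [v] and of [x] are covered by U, so is a power of [[~ v, x]]:
    the [x] for which this holds, [v] being fixed, form a subgroup that contains
    U and P', hence suitable powers of the generators, hence the generators. *)
Let LI n : L n `<=` I n.
Proof.
have sXP : X `<=` P by rewrite genX; apply: sub_gen.
elim: n => [|n IH].
  rewrite {1}/L /= genX; apply: gen_sub => // x Xx.
  split; first exact: sXP.
  have [_ [m gm Ux]] := goodX Xx; exists m => //; split=> //.
  by apply: subgroupX => //; apply: sXP.
apply: gen_sub => // _ [v [x [Lv Px ->]]].
have [_ [m gm [Lvm [u0 Uu0 Lw]]]] := IH v Lv.
have Pv : P v by apply: LP Lv.
suff sub : P `<=` [set x | P x /\ I n.+1 [~ v, x]] by case: (sub x Px).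
have sgS := @centraliser_mod P _ sgP (sgI n.+1) (@nI n.+1) v.
set S := [set _ | _] in sgS *.
have sL1S : L 1 `<=` S.
  by move=> y L1y; split; [apply: LP L1y|apply: WI; apply: LW; apply: comm_derived].
have sUS : U `<=` S.
  move=> u Uu; have Pu := sUP Uu; split=> //; split; first exact: LR.
  exists m => //.
  have Lu0 : L n u0.
    rewrite -(invgK u0); apply: subgroupV => //.
    by apply: (subgroup_mull (sgL n) Lvm); apply: LS.
  have Lc : L n.+1 [~ u0, u] by apply: LR.
  have Wc : W n.+1 [~ v ^+ m, u].
    split; first exact: LR.
    exists [~ u0, u]; first exact: subgroupR.
    rewrite -(mulVKg u0 (v ^+ m)); set w := u0^-1 * _ in Lw *.
    rewrite commgMl (conjg_mulR [~ u0, u] w) -mulgA mulKg.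
    apply: (subgroupM (sgL n.+2)); apply: LR => //.
    exact: LP Lw.
  have := mod_commgXl sgP (sgL n.+2) (@nL n.+2) m Pv Pu (LR (LR Lv Pu) Pv).
  by move=> /LW /(subgroup_mull (sgW n.+1) Wc) /(subgroupV (sgW n.+1)); rewrite invgK.
rewrite genX; apply: gen_sub => // y Xy; have Py := sXP y Xy.
split=> //; split; first exact: LR.
have [_ [k gk [u Uu Luy]]] := goodX Xy.
have [_ Iyk] : S (y ^+ k).
  by rewrite -(mulVKg u (y ^+ k)); apply: (subgroupM sgS); [apply: sUS|apply: sL1S].
have := mod_commgXr sgP (sgL n.+2) (@nL n.+2) k Pv Py (LR (LR Lv Py) Py).
move=> /LW /WI /(subgroup_mull (sgI n.+1) Iyk) /(subgroupV (sgI n.+1)).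
rewrite invgK => -[_ [l gl]]; rewrite -expgnA => Wkl.
by exists (k * l)%N => //; apply: goodM.
Qed.

(** Descending the lower central series: x^m = u w with w in its n-th term; a
    power of w is covered by U, and w commutes with u modulo the next term, so a
    power of x agrees with an element of U modulo that term. *)
Lemma nilpotent_isolator : nilpotent_subgroup P -> P `<=` isolator P U.
Proof.
move=> /(lower_central_nilpotent sgP)[c Lc1] x Px; split=> //.
suff [m gm [u Uu /Lc1 /= ux1]] : exists2 m, good m & mulset U (L c) (x ^+ m).
  by exists m => //; rewrite -(mulVKg u (x ^+ m)) ux1 mulg1.
elim: c {Lc1} => [|n [m gm [u Uu Lux]]].
  by exists 1%N => //; apply: mulset_subr.
have [_ [k gk [_ [u' Uu' Lu']]]] := @LI n _ Lux.
exists (m * k)%N; first exact: goodM.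
exists (u ^+ k * u'); first by apply: subgroupM => //; apply: subgroupX.
set w := u^-1 * _ in Lux Lu'; have Pu := sUP Uu.
have := mod_expgMn sgP (sgL n.+1) (@nL n.+1) k Pu (@LP n _ Lux) (LR Lux Pu).
rewrite mulVKg -expgnA => /(subgroupM (sgL n.+1) Lu').
by rewrite !gnorm.
Qed.

End Nilpotent.
End Isolator.

(** * The transfinite upper central series *)

Section UpperCentral.
Variable K : set G.
Hypothesis sgK : subgroup K.

Lemma upper_central1 a : upper_central K a 1.
Proof.
elim: a => [//|a IH|T f _]; last by left.
by split; [apply: subgroup1|move=> y _; rewrite comm1g].
Qed.

Lemma upper_central_sub a : upper_central K a `<=` K.
Proof.
elim: a => [x ->|a _ x []//|T f IH x [->|[t _ /IH]]//]; exact: subgroup1.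
Qed.

Lemma le_upper_central a b :
  ord_le a b -> upper_central K a `<=` upper_central K b.
Proof.
elim: a b => [|a IH|T f IH] b le_ab x.
- by move=> ->; apply: upper_central1.
- elim: b le_ab => [//|b _ /IH sZ [Kx Zx]|T g IHg [t lt_at] Zx].
    by split=> // y /Zx /sZ.
  by right; exists t => //; apply: IHg.
- move=> [->|[t _]]; first exact: upper_central1.
  exact/IH/le_ab.
Qed.

(** At a limit the terms of the union form a chain, even when the family of
    ordinals is not monotone, because [ord_le] is total. *)
Lemma upper_centralP a :
  subgroup (upper_central K a) /\ normalises K (upper_central K a).
Proof.
elim: a => [|a [sgZ nZ]|T f IH].
- by split; [apply: subgroup_set1|move=> q m _ ->; rewrite /= conj1g].
- by split; [apply: subgroup_next_center|apply: normalises_next_center].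
split; last first.
  move=> q m Kq [->|[t _ Zm]]; first by left; rewrite /= conj1g.
  by right; exists t => //; apply: (IH t).2.
apply: subgroup_of => [|x y [->|[t _ Zx]] [->|[s _ Zy]]|x [->|[t _ Zx]]].
- by left.
- by left; rewrite /= mulg1.
- by right; exists s => //; rewrite mul1g.
- by right; exists t => //; rewrite mulg1.
- right; have [le|/ord_ltW le] := ord_le_total (f t) (f s).
    by exists s => //; apply: (subgroupM (IH s).1) => //; apply: le_upper_central le _ Zx.
  by exists t => //; apply: (subgroupM (IH t).1) => //; apply: le_upper_central le _ Zy.
- by left; rewrite /= invg1.
- by right; exists t => //; apply: (subgroupV (IH t).1).
Qed.

Lemma subgroup_upper_central a : subgroup (upper_central K a).
Proof. by case: (upper_centralP a). Qed.

Lemma normalises_upper_central a : normalises K (upper_central K a).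
Proof. by case: (upper_centralP a). Qed.

End UpperCentral.

Lemma upper_central_restrict H K a : subgroup H -> H `<=` K ->
  H `&` upper_central K a `<=` upper_central H a.
Proof.
move=> sgH sHK.
elim: a => [x []//|a IH x [Hx [_ Zx]]|T f IH x [Hx [->|[t _ Zx]]]].
- split=> // y Hy; apply: IH; split; first exact: subgroupR.
  exact/Zx/sHK.
- by left.
- by right; exists t => //; apply: IH.
Qed.

(** * Automorphisms forced by a hereditary Aut-basis *)

Lemma automorphism_of K f f' :
  (forall x, K x -> K (f x)) -> (forall x, K x -> K (f' x)) ->
  (forall x, K x -> f' (f x) = x) -> (forall x, K x -> f (f' x) = x) ->
  (forall x y, K x -> K y -> f (x * y) = f x * f y) -> automorphism K f.
Proof.
move=> Kf Kf' fK f'K fM; split; last by move=> x y; rewrite !inE; apply: fM.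
split; first by [].
- by move=> x y; rewrite !inE => Kx Ky eq_f; rewrite -(fK x) // eq_f fK.
- by move=> x Kx; exists (f' x); [apply: Kf'|apply: f'K].
Qed.

Lemma conj_automorphism K x : subgroup K -> K x ->
  automorphism K (fun y => y ^ x).
Proof.
move=> sgK Kx; apply: (automorphism_of (f' := fun y => y ^ x^-1)).
- by move=> y Ky; apply: subgroupJ.
- by move=> y Ky; apply: subgroupJ => //; apply: subgroupV.
- by move=> y _; rewrite conjgK.
- by move=> y _; rewrite conjgKV.
- by move=> y z _ _; rewrite conjMg.
Qed.

Lemma hereditary_eq H L f1 f2 : hereditary_aut_basis H [set: G] ->
  subgroup L -> H `<=` L -> automorphism L f1 -> automorphism L f2 ->
  (forall h, H h -> f1 h = f2 h) -> forall x, L x -> f1 x = f2 x.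
Proof.
move=> [_ hered] sgL sHL af1 af2 eqH x Lx.
have [_ autL] := hered L sgL sHL (fun _ _ => I).
by apply: (autL f1 f2 af1 af2) => [h|]; rewrite inE //; apply: eqH.
Qed.

Definition central : set G := [set z | forall y, commute z y].

(** Conjugation by [c] and the identity agree on H. *)
Lemma central_of_centralises H : hereditary_aut_basis H [set: G] ->
  forall c, (forall h, H h -> commute c h) -> central c.
Proof.
move=> herH c cH y; apply/commute_sym/commgP; rewrite -conjg_fix; apply/eqP.
apply: (hereditary_eq (f1 := fun y => y ^ c) (f2 := id) herH subgroupT) => //.
- by apply: conj_automorphism => //; apply: subgroupT.
- exact: (automorphism_of (f' := id)).
- by move=> h /cH /commute_sym /commgP; rewrite -conjg_fix => /eqP.
Qed.

Lemma central_subgroup : subgroup central.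
Proof.
apply: subgroup_of => [y|x y cx cy z|x cx z].
- by apply/commute_sym/commute1.
- by apply/commute_sym/commuteM; apply: commute_sym.
- by apply/commute_sym/commuteV/commute_sym.
Qed.

(** The exponents [k] for which every torsion argument below works: the centre of
    the group, which is never trivial in the application, has no k-torsion. *)
Definition torsion_free_exponent k :=
  (0 < k)%N /\ forall z, central z -> z ^+ k = 1 -> z = 1.

Lemma torsion_free_exponent1 : torsion_free_exponent 1%N.
Proof. by split=> // z _; rewrite expg1. Qed.

Lemma torsion_free_exponentM m n : torsion_free_exponent m ->
  torsion_free_exponent n -> torsion_free_exponent (m * n)%N.
Proof.
move=> [m0 tfm] [n0 tfn]; split; first by rewrite muln_gt0 m0.
move=> z cz; rewrite expgnA => /tfn zm1; apply: tfm => //; apply: zm1.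
exact: (subgroupX central_subgroup).
Qed.

(** If [x] is in the (a+1)-st upper centre of H, then for h in H the elements
    h^x = h [h, x] and h act in the same way on N by the induction hypothesis,
    because [h, x] is in the a-th upper centre. So hn |-> h^x n is an
    automorphism of HN; it coincides with conjugation by [x] on H, thus on N,
    where it is the identity. *)
Lemma complement_centralised H N a : subgroup H -> hereditary_aut_basis H [set: G] ->
  subgroup N -> normalises H N -> (forall x, H x -> N x -> x = 1) ->
  forall x n, upper_central H a x -> N n -> commute x n.
Proof.
move=> sgH herH sgN nHN HN1.
set L := mulset H N.
have sHL : H `<=` L by apply: mulset_subl.
have sNL : N `<=` L by apply: mulset_subr.
have sgL : subgroup L by apply: subgroup_mulset.
have Lhn x : L x -> exists h n, [/\ H h, N n & x = h * n].
  by case=> h Hh Nn; exists h, (h^-1 * x); rewrite mulVKg.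
(* The projection of HN onto H, with the value 1 outside HN. *)
have [p pE] : exists p : G -> G, forall h n, H h -> N n -> p (h * n) = h.
  have [x|p pP] := @choice G G (fun x h => forall h' n, H h' -> N n -> x = h' * n -> h = h').
    have [/Lhn[h [n [Hh Nn ->]]]|notL] := pselect (L x); last first.
      by exists 1 => h n Hh Nn defx; case: notL; rewrite defx; apply: mem_mulset.
    exists h => h' n' Hh' Nn' eq_x; apply/divg1_eq/HN1.
      by apply: subgroupM => //; apply: subgroupV.
    have -> : h / h' = (n' / n) ^ h^-1.
      have -> : n' = h'^-1 * (h * n) by rewrite eq_x mulKg.
      by rewrite /conjg !gnorm.
    apply: nHN; first exact: subgroupV.
    by apply: subgroupM => //; apply: subgroupV.
  by exists p => h n Hh Nn; apply: pP Hh Nn erefl.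
pose f x y := p y ^ x * ((p y)^-1 * y).
have fE x h n : H h -> N n -> f x (h * n) = h ^ x * n.
  by move=> Hh Nn; rewrite /f pE // mulKg.
elim: a => [x n -> _|a IH x n Zx Nn|T g IH x n [->|[t _ Zx]] Nn].
- exact/commute_sym/commute1.
- have sgZ := subgroup_upper_central sgH (OSucc a).
  have Zx' := subgroupV sgZ Zx.
  have [Hx [Hx' _]] := (Zx.1, Zx').
  have Lf y z : H y -> L z -> L (f y z).
    move=> Hy /Lhn[h [m [Hh Nm ->]]]; rewrite fE //.
    by apply: mem_mulset => //; apply: subgroupJ.
  have fK y z : H y -> L z -> f y^-1 (f y z) = z.
    move=> Hy /Lhn[h [m [Hh Nm ->]]]; rewrite fE // fE ?conjgK //.
    exact: subgroupJ.
  have af : automorphism L (f x).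
    apply: (automorphism_of (f' := f x^-1)).
    - by move=> y; apply: Lf.
    - by move=> y; apply: Lf.
    - by move=> y; apply: fK.
    - by move=> y; rewrite -{1}(invgK x); apply: fK.
    move=> _ _ /Lhn[h [m [Hh Nm ->]]] /Lhn[h' [m' [Hh' Nm' ->]]].
    have -> : h * m * (h' * m') = h * h' * (m ^ h' * m') by rewrite /conjg !gnorm.
    have Nmh : N (m ^ h') by apply: nHN.
    rewrite !fE //; [|exact: subgroupM|exact: subgroupM].
    have Zc : upper_central H a [~ h', x].
      by apply: (subgroup_commC (subgroup_upper_central sgH a)); apply: Zx.2.
    have -> : m ^ h' = m ^ (h' ^ x).
      rewrite (conjg_mulR h') conjgM; apply/esym/eqP; rewrite conjg_fix.
      exact/commgP/commute_sym/IH.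
    by rewrite /conjg !gnorm.
  have eqN : n ^ x = f x n.
    apply: (hereditary_eq (f1 := fun y => y ^ x) herH sgL sHL _ af); last exact: sNL.
      by apply: conj_automorphism => //; apply: sHL.
    by move=> h Hh; rewrite -{2}(mulg1 h) fE ?mulg1 //; apply: subgroup1.
  apply/commute_sym/commgP; rewrite -conjg_fix eqN -{1}(mul1g n) fE //.
    by rewrite conj1g mul1g.
  exact: subgroup1.
- exact/commute_sym/commute1.
- exact: IH Zx Nn.
Qed.

(** The last hypotheses say that K / D is cyclic, generated by the class of [g].
    If no torsion-free power of [g] is in D, the order of that class is infinite
    or divisible by the order of some central [z <> 1]; mapping [g] to [z] gives a
    homomorphism phi from K to the centre which kills D, and x |-> x phi(x) is an
    automorphism of K. It fixes H, hence is the identity, although it maps [g]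
    to [g * z]. *)
Lemma cyclic_quotient H D K g z0 : hereditary_aut_basis H [set: G] ->
  central `<=` H -> central z0 -> z0 <> 1 ->
  subgroup K -> subgroup D -> H `<=` D -> D `<=` K -> normalises K D -> K g ->
  (forall L, subgroup L -> D `<=` L -> L g -> K `<=` L) ->
  exists2 k, torsion_free_exponent k & D (g ^+ k).
Proof.
move=> herH sCH cz0 z0N1 sgK sgD sHD sDK nD Kg Kmin.
apply: contrapT => noD.
have [z [cz zN1 zD]] : exists z, [/\ central z, z <> 1 &
    forall n, D (g ^+ n) -> z ^+ n = 1].
  have [[n [n0 Dn]]|inf] := pselect (exists n, (0 < n)%N /\ D (g ^+ n)); last first.
    exists z0; split=> // -[|n Dn]; first by rewrite expg0.
    by case: inf; exists n.+1.
  have {n n0 Dn} exn : exists n, (0 < n)%N && `[< D (g ^+ n) >].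
    by exists n; rewrite n0; apply/asboolP.
  have [m /andP[m0 /asboolP Dm] m_min] := ex_minnP exn.
  apply: contrapT => noz; apply: noD; exists m => //; split=> // z cz zm1.
  apply: contrapT => zN1; apply: noz; exists z; split=> // n Dn.
  have D_mod : D (g ^+ (n %% m)).
    move: Dn; rewrite {1}(divn_eq n m) expgnDr mulnC expgnA.
    by apply: subgroup_mulr => //; apply: subgroupX.
  have -> : n = (m * (n %/ m))%N.
    rewrite {1}(divn_eq n m) mulnC; case: (posnP (n %% m)) => [->|r0].
      by rewrite addn0.
    have := m_min (n %% m)%N; rewrite r0 leqNgt ltn_mod m0 /=.
    by move=> /(_ (asboolT D_mod)).
  by rewrite expgnA zm1 expg1n.
have zz m n : D ((g ^+ m)^-1 * g ^+ n) -> z ^+ m = z ^+ n.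
  wlog le_mn : m n / (m <= n)%N => [IH|] Dmn.
    case/orP: (leq_total m n) => [|le_nm]; first by move/IH; apply.
    by apply/esym/IH => //; move: (subgroupV sgD Dmn); rewrite !gnorm.
  move: Dmn; rewrite -(subnKC le_mn) !expgnDr mulKg => /zD ->.
  by rewrite mulg1.
have cgg m n : g ^+ m * g ^+ n = g ^+ n * g ^+ m by rewrite -!expgnDr addnC.
have Kgn n : K (g ^+ n) by apply: subgroupX.
(* R x i j says that x and g^(i - j) have the same class modulo D; a pair of
   natural numbers replaces an integer exponent. *)
pose R x i j := D ((g ^+ i)^-1 * x * g ^+ j).
have RM x y i j i' j' : R x i j -> R y i' j' -> R (x * y) (i + i')%N (j + j')%N.
  rewrite /R => Rx Ry.
  have -> : (g ^+ (i + i'))^-1 * (x * y) * g ^+ (j + j') =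
     ((g ^+ i)^-1 * x * g ^+ j) ^ (g ^+ i') * ((g ^+ i')^-1 * y * g ^+ j') ^ g ^+ j.
    rewrite [(j + j')%N]addnC /conjg !expgnDr !gnorm.
    by rewrite -(mulgA _ (g ^+ j) (g ^+ i')) (cgg j i') !gnorm.
  by apply: subgroupM => //; apply: nD.
have RV x i j : R x i j -> R x^-1 j i.
  by rewrite /R => /(subgroupV sgD); rewrite !gnorm.
have RH x : D x -> R x 0%N 0%N by rewrite /R expg0 !gnorm.
have Rg : R g 1%N 0%N by rewrite /R expg0 expg1 !gnorm; apply: (subgroup1 sgD).
have Rex x : K x -> exists i j, R x i j.
  have sub : K `<=` [set x | exists i j, R x i j].
    apply: Kmin => [|y Dy|]; last by exists 1%N, 0%N.
      apply: subgroup_of => [|x' y [i [j Rx]] [i' [j' Ry]]|y [i [j Ry]]].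
      - by exists 0%N, 0%N; apply: RH; apply: subgroup1.
      - by exists (i + i')%N, (j + j')%N; apply: RM.
      - by exists j, i; apply: RV.
    by exists 0%N, 0%N; apply: RH.
  exact: sub.
have Rz x i j i' j' : R x i j -> R x i' j' -> z ^+ i / z ^+ j = z ^+ i' / z ^+ j'.
  move=> Rx Rx'.
  have eq_z : z ^+ (i + j') = z ^+ (i' + j).
    apply/esym/zz; rewrite [(i' + j)%N]addnC.
    by have := RM _ _ _ _ _ _ (RV _ _ _ Rx) Rx'; rewrite /R !gnorm.
  rewrite -(mulgK (z ^+ j') (z ^+ i)) -expgnDr eq_z expgnDr -!mulgA; congr (_ * _).
  by rewrite -invgM -expgnDr addnC expgnDr invgM mulgA mulgV mul1g.
have [phi phiE] : exists phi : G -> G,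
    forall x i j, R x i j -> phi x = z ^+ i / z ^+ j.
  have [x|phi phiP] := @choice G G (fun x c => forall i j, R x i j -> c = z ^+ i / z ^+ j).
    have [[i [j Rx]]|noR] := pselect (exists i j, R x i j).
      by exists (z ^+ i / z ^+ j) => i' j'; apply: Rz.
    by exists 1 => i j Rx; case: noR; exists i, j.
  by exists phi => x i j; apply: phiP.
have sgC := central_subgroup.
have cphi x : K x -> central (phi x).
  move=> /Rex[i [j /phiE ->]]; apply: (subgroupM sgC); last apply: (subgroupV sgC).
    exact: (subgroupX sgC).
  exact: (subgroupX sgC).
have phic x c : K x -> central c -> phi (x * c) = phi x.
  move=> /Rex[i [j Rx]] cc; rewrite (phiE _ _ _ Rx).
  have /RH Rc : D c by apply/sHD/sCH.
  by have /phiE := RM _ _ _ _ _ _ Rx Rc; rewrite !addn0.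
have phiM x y : K x -> K y -> phi (x * y) = phi x * phi y.
  move=> /Rex[i [j Rx]] /[dup] Ky /Rex[i' [j' Ry]].
  rewrite (phiE _ _ _ (RM _ _ _ _ _ _ Rx Ry)) (phiE _ _ _ Rx).
  rewrite (phiE _ _ _ Ry) !expgnDr invgM -!mulgA; congr (_ * _).
  have cj : central (z ^+ j)^-1 by apply: (subgroupV sgC); apply: (subgroupX sgC).
  by rewrite [RHS](cj _) -!mulgA.
have Kc c : central c -> K c by move=> /sCH /sHD /sDK.
have Kphi x : K x -> K (phi x) by move=> /cphi /Kc.
have af : automorphism K (fun x => x * phi x).
  apply: (automorphism_of (f' := fun x => x * (phi x)^-1)).
  - by move=> x Kx; apply: subgroupM => //; apply: Kphi.
  - by move=> x Kx; apply: subgroupM => //; apply: subgroupV => //; apply: Kphi.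
  - by move=> x Kx; rewrite phic ?mulgK //; apply: cphi.
  - move=> x Kx; rewrite phic ?mulgVK //; by apply: (subgroupV sgC); apply: cphi.
  - move=> x y Kx Ky; rewrite phiM // -!mulgA; congr (_ * _).
    by rewrite mulgA [y * phi x](commute_sym (cphi x Kx y)) -mulgA.
have aid : automorphism K id by apply: (automorphism_of (f' := id)).
have fixK : forall x, K x -> x * phi x = x.
  apply: (hereditary_eq herH sgK (subset_trans sHD sDK) af aid) => h Hh.
  have Rh : R h 0%N 0%N by apply/RH/sHD.
  by rewrite (phiE _ _ _ Rh) divg1 mulg1.
apply: zN1; apply: (mulgI g).
by have := fixK g Kg; rewrite (phiE _ _ _ Rg) expg1 expg0 divg1 mulg1.
Qed.

(** The case D = HK', where K is generated by H and [g]. *)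
Lemma power_in_derived H g z0 : subgroup H -> hereditary_aut_basis H [set: G] ->
  central `<=` H -> central z0 -> z0 <> 1 ->
  let K := gen (H `|` [set g]) in
  exists2 k, torsion_free_exponent k & mulset H (lower_central K 1) (g ^+ k).
Proof.
move=> sgH herH sCH cz0 z0N1 K.
have sgK : subgroup K by apply: subgroup_gen.
have sHK : H `<=` K by move=> h Hh; apply: sub_gen; left.
have Kg : K g by apply: sub_gen; right.
have sgK' := subgroup_lower_central sgK 1.
have nKK' := normalises_lower_central sgK (n := 1).
have sK'K := lower_central_sub sgK (n := 1).
have sHD : H `<=` mulset H (lower_central K 1) by apply: mulset_subl.
have sDK : mulset H (lower_central K 1) `<=` K by apply: mulset_sub.
have sgD : subgroup (mulset H (lower_central K 1)).
  by apply: subgroup_mulset => // q x /sHK; apply: nKK'.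
apply: (cyclic_quotient herH sCH cz0 z0N1 sgK sgD) => // [q x Kq Dx|L sgL sDL Lg].
  rewrite conjg_mulR; apply: (subgroupM sgD) => //.
  by apply: mulset_subr => //; apply: lower_centralR => //; apply: sDK.
by apply: gen_sub => // x [/sHD /sDL|->].
Qed.

Section LocallyNilpotent.
Hypothesis lnG : locally_nilpotent [set: G].

Lemma finite_gen_nilpotent (F : set G) : finite_set F -> nilpotent_subgroup (gen F).
Proof.
by move=> fF; apply: lnG => //; [apply: subgroup_gen|exists F].
Qed.

(** Let w_0 = v and w_(i+1) = [w_i, u]. This sequence reaches 1, and every w_i
    commutes with u^k modulo M. If w_(i+2) is in M then w_(i+1) commutes with u
    modulo M, so w_(i+1)^k is congruent to [w_i, u^k], which is in M, and
    w_(i+1) is in M. Going down, w_1 = [v, u] is in M. Torsion is excluded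
    only among the terms of the sequence, because an induction along the upper
    central series of a subgroup controls no other elements. *)
Lemma commg_root M k u v : subgroup M -> normalises [set: G] M ->
  (forall i, let w := iter i.+1 (fun w => [~ w, u]) v in M (w ^+ k) -> M w) ->
  M [~ v, u ^+ k] -> M [~ v, u].
Proof.
move=> sgM nM isoM Mvuk.
set w := fun i => iter i (fun w => [~ w, u]) v.
have [c wc1] : exists c, w c = 1.
  apply: (@nilpotent_commg (gen [set u; v])).
  - by apply: finite_gen_nilpotent; rewrite finite_setU; split; apply: finite_set1.
  - by apply: sub_gen; left.
  - by apply: sub_gen; right.
have Mwuk i : M [~ w i, u ^+ k].
  elim: i => [//|i IH]; rewrite [w _]/commg -/(w i) commgMl commgVl.
  apply: subgroupM => //.
    by do 2!apply: (nM) => //; apply: subgroupV.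
  have -> : [~ w i ^ u, u ^+ k] = [~ w i, u ^+ k] ^ u.
    rewrite conjRg; congr [~ _, _].
    by apply/esym/conjg_fixP; rewrite commg1_sym commgXg.
  exact: nM.
have down i : M (w i.+2) -> M (w i.+1).
  move=> Mw2; apply: isoM.
  have := mod_commgXr subgroupT sgM nM k (v := w i) (x := u) I I Mw2.
  by move=> /(subgroup_mull sgM (Mwuk i)) /(subgroupV sgM); rewrite invgK.
have : M (w c.+1) by rewrite [w _]/= -/(w c) wc1 comm1g; apply: subgroup1.
by elim: (c) => [//|i IH] /down /IH.
Qed.
End LocallyNilpotent.

(** * The case of a basis containing the centre of the group *)

Section Rigid.
Hypothesis lnG : locally_nilpotent [set: G].
Variable H : set G.
Hypotheses (sgH : subgroup H) (herH : hereditary_aut_basis H [set: G]).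
Hypothesis sCH : central `<=` H.

(** By [power_in_derived], g^k = h w, where w already lies in the derived
    subgroup of the subgroup generated by a finite set F of elements of H and
    [g]. Everything takes place in the nilpotent group P generated by F, [g] and
    [h], whose intersection U with H contains all these generators but [g]. *)
Lemma power_in_basis z g : central z -> z <> 1 ->
  exists2 k, torsion_free_exponent k & H (g ^+ k).
Proof.
move=> cz zN1.
have [k tfk [h Hh /derived_finite[F [fF sF Fw]]]] :=
  power_in_derived g sgH herH sCH cz zN1.
pose X := F `|` [set h; g]; pose P := gen X.
have sgP : subgroup P := subgroup_gen X.
have nP : nilpotent_subgroup P.
  apply: finite_gen_nilpotent => //; rewrite !finite_setU.
  by do !split => //; apply: finite_set1.
have Ph : P h by apply: sub_gen; right; left.
have Pg : P g by apply: sub_gen; right; right.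
have goodX : X `<=` isolator torsion_free_exponent P
    (mulset (H `&` P) (lower_central P 1)).
  move=> x Xx; have Px : P x by apply: sub_gen.
  split=> //; have [Hx|HNx] := pselect (H x).
    exists 1%N; first exact: torsion_free_exponent1.
    apply: mulset_subl; last by rewrite expg1.
    exact: subgroup_lower_central.
  suff -> : x = g.
    exists k => //; exists h => //.
    by apply: lower_central_mono Fw; apply: gen_mono => y Fy; left.
  case: Xx => [/sF[]//|[xh|//]].
  by case: HNx; rewrite xh.
have sUP : H `&` P `<=` P by move=> x [].
have [_ [m tfm [Hm _]]] := nilpotent_isolator torsion_free_exponent1
  torsion_free_exponentM sgP (subgroup_setI sgH sgP) sUP erefl goodX nP Pg.
by exists m.
Qed.

Hypothesis central_of : forall c, H c -> (forall h, H h -> commute c h) -> central c.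

(** If x^k = 1, then [x] commutes with every h in H: the iterated commutators of
    [h] with [x] that occur in [commg_root] lie in the a-th upper centre, which
    has no k-torsion by induction. So [x] is central. *)
Lemma upper_central_torsion_free a k x : torsion_free_exponent k ->
  upper_central H a x -> x ^+ k = 1 -> x = 1.
Proof.
move=> tfk; elim: a x => [x -> //|a IH x [Hx Zx] xk1|T f IH x [//|[t _]]]; last exact: IH.
apply: tfk.2 => //; apply: central_of => // h Hh.
apply/commute_sym/commgP/eqP.
apply: (commg_root (k := k) lnG (M := [set 1])); first exact: subgroup_set1.
- by move=> q m _ ->; rewrite /= conj1g.
- move=> i w wk1; have sgZ := subgroup_upper_central sgH a.
  apply: IH => //; rewrite /w; elim: i {w wk1} => [|i IHi].
    by apply: subgroup_commC => //; apply: Zx.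
  rewrite iterS; apply: subgroup_commC => //; apply: Zx.
  exact: (upper_central_sub sgH IHi).
- by rewrite xk1 /= commg1.
Qed.

Variable lam : ordinal_tree.
Hypothesis hyperH : upper_central H lam = H.

(** The subgroup N generated by the conjugates of [t] under H is locally
    generated by finitely many elements of order dividing k, so by nilpotency
    all its elements have a torsion-free exponent. Hence N meets H trivially, is
    centralised by H, and lies in the centre, thus in H. *)
Lemma torsion_free k (t : G) : torsion_free_exponent k -> t ^+ k = 1 -> t = 1.
Proof.
move=> tfk tk1.
set X := [set t ^ h | h in H].
set N := gen X; have sgN : subgroup N := subgroup_gen X.
have nHN : normalises H N.
  apply: gen_normalises => // q _ Hq [h Hh <-].
  by exists (h * q); [apply: subgroupM|rewrite conjgM].
have Nt : N t by apply: sub_gen; exists 1; [apply: subgroup1|rewrite conjg1].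
have torN n : N n -> exists2 m, torsion_free_exponent m & n ^+ m = 1.
  move=> /gen_finite[F [fF sFX Fn]].
  have s1P : [set 1] `<=` gen F by move=> _ ->; apply: (subgroup1 (subgroup_gen F)).
  have goodF : F `<=` isolator torsion_free_exponent (gen F)
      (mulset [set 1] (lower_central (gen F) 1)).
    move=> x Fx; split; first exact: sub_gen.
    exists k => //; have [h Hh <-] := sFX x Fx; rewrite -conjXg tk1 conj1g.
    by apply/mulset_subl/erefl/subgroup_lower_central/subgroup_gen.
  have [_ [m tfm nm]] := nilpotent_isolator torsion_free_exponent1
    torsion_free_exponentM (subgroup_gen F) subgroup_set1 s1P erefl goodF
    (finite_gen_nilpotent lnG fF) Fn.
  by exists m.
have HN1 x : H x -> N x -> x = 1.
  rewrite -{1}hyperH => Zx /torN[m tfm].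
  exact: (upper_central_torsion_free tfm Zx).
apply: (HN1) => //; apply: sCH; apply: (central_of_centralises herH) => h.
rewrite -hyperH => Zh; apply: commute_sym.
exact: (complement_centralised sgH herH sgN nHN HN1 Zh Nt).
Qed.

Let sgT := subgroupT.

Lemma upper_central_isolated a k u : torsion_free_exponent k ->
  upper_central [set: G] a (u ^+ k) -> upper_central [set: G] a u.
Proof.
move=> tfk; elim: a u => [u|a IH u [_ Zu]|T f IH u [|[t _ Zu]]].
- exact: torsion_free.
- have sgA := subgroup_upper_central sgT a.
  split=> // y _; apply: subgroup_commC => //.
  apply: (commg_root (k := k) lnG) => //; first exact: normalises_upper_central.
    by move=> i w; apply: IH.
  by apply: subgroup_commC => //; apply: Zu.
- by move=> u1; left; apply: torsion_free u1.
- by right; exists t => //; apply: IH.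
Qed.

(** For x in the (a+1)-st upper centre of H and g in G, some torsion-free power
    g^k is in H, so [x, g^k] is in the a-th upper centre of G, modulo which
    there is no k-torsion. *)
Lemma upper_central_ascend z a : central z -> z <> 1 ->
  upper_central H a `<=` upper_central [set: G] a.
Proof.
move=> cz zN1; elim: a => [//|a IH x [Hx Zx]|T f IH x [->|[t _ /IH Zx]]].
- split=> // g _; have [k tfk Hgk] := power_in_basis g cz zN1.
  have sgA := subgroup_upper_central sgT a.
  apply: (commg_root (k := k) lnG) => //; first exact: normalises_upper_central.
    by move=> i w; apply: upper_central_isolated.
  by apply: IH; apply: Zx.
- by left.
- by right; exists t.
Qed.

Lemma upper_central_basis_full z a : central z -> z <> 1 ->
  upper_central H a = H -> upper_central [set: G] a = [set: G].
Proof.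
move=> cz zN1 ZH; apply/seteqP; split=> // g _.
have [k tfk Hgk] := power_in_basis g cz zN1.
apply: (upper_central_isolated tfk); apply: (upper_central_ascend cz zN1).
by rewrite ZH.
Qed.

End Rigid.

(** * The general case and the theorem *)

(** A hypercentral group with trivial centre is trivial. *)
Lemma upper_central_trivial K : (forall x, K x -> (forall y, K y -> commute x y) -> x = 1) ->
  forall a, upper_central K a `<=` [set 1].
Proof.
move=> K1; elim=> [//|a IH x [Kx Zx]|T f IH x [//|[t _ /IH//]]].
by apply: K1 => // y Ky; apply/commgP/eqP/IH/Zx.
Qed.

(** The basis H is replaced by its product H1 with the centre. At stage 0 the
    upper central series of H1 does not contain the centre, so the series of H
    and H1 have the same length only because H is nontrivial. *)
Lemma upper_central_full H a : locally_nilpotent [set: G] ->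
  subgroup H -> H <> [set 1] -> hereditary_aut_basis H [set: G] ->
  upper_central H a = H -> upper_central [set: G] a = [set: G].
Proof.
move=> lnG sgH HN1 herH ZH.
have sgC := central_subgroup.
pose H1 := mulset H central.
have sHH1 : H `<=` H1 by apply: mulset_subl.
have sCH1 : central `<=` H1 by apply: mulset_subr.
have sgH1 : subgroup H1.
  apply: subgroup_mulset => // q c _ cc.
  by rewrite (_ : c ^ q = c) //; apply/eqP; rewrite conjg_fix; apply/commgP.
have herH1 : hereditary_aut_basis H1 [set: G].
  split=> // L sgL sH1L _; split=> // f1 f2 af1 af2 eq12 x; rewrite inE => Lx.
  apply: (hereditary_eq herH sgL _ af1 af2) => // [|h /sHH1 H1h].
    exact: subset_trans sHH1 sH1L.
  by apply: eq12; rewrite inE.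
have cH c : (forall h, H h -> commute c h) -> central c.
  exact: central_of_centralises.
have [z [cz zN1]] : exists z, central z /\ z <> 1.
  apply: contrapT => noz; apply: HN1; apply/seteqP; split; last first.
    by move=> _ ->; apply: subgroup1.
  rewrite -ZH; apply: upper_central_trivial => x Hx xH.
  by apply: contrapT => xN1; apply: noz; exists x; split=> //; apply: cH.
have sZ b : upper_central H b `<=` upper_central H1 b.
  elim: b => [//|b IH x [Hx Zx]|T f IH x [->|[t _ /IH Zx]]].
  - split=> [|y [h Hh cc]]; first exact: sHH1.
    rewrite -(mulVKg h y); set c := h^-1 * y in cc *.
    rewrite commgMr (_ : [~ x, c] = 1); last exact/eqP/commgP/commute_sym/cc.
    rewrite mul1g (_ : _ ^ c = [~ x, h]); last first.
      by apply/eqP; rewrite conjg_fix; apply/commgP/commute_sym/cc.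
    by apply: IH; apply: Zx.
  - by left.
  - by right; exists t.
have dichotomy b : upper_central H1 b `<=` [set 1] \/ central `<=` upper_central H1 b.
  elim: b => [|b _|T f IH]; first by left.
    right=> c cc; split=> [|y _]; first exact: sCH1.
    rewrite (_ : [~ c, y] = 1); last exact/eqP/commgP.
    exact: upper_central1.
  have [[t st]|no_t] := pselect (exists s, central `<=` upper_central H1 (f s)).
    by right=> c /st; right; exists t.
  left=> x [//|[t _ Zx]]; case: (IH t) => [/(_ _ Zx)//|st].
  by case: no_t; exists t.
have ZH1 : upper_central H1 a = H1.
  apply/seteqP; split; first exact: upper_central_sub.
  case: (dichotomy a) => [s1|sC].
    case: HN1; apply/seteqP; split; last by move=> _ ->; apply: subgroup1.
    by rewrite -ZH; apply: subset_trans s1; apply: sZ.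
  apply: mulset_sub => //; first exact: subgroup_upper_central.
  by move=> h Hh; apply: sZ; rewrite ZH.
apply: (upper_central_basis_full lnG sgH1 herH1 sCH1 _ ZH1 cz zN1 ZH1) => c _ cH1.
by apply: cH => h /sHH1; apply: cH1.
Qed.

Lemma iter_upper_central K n :
  upper_central K (iter n OSucc OZero) = iter n (next_center K) [set 1].
Proof. by elim: n => [//|n /= ->]. Qed.

End Groups.

Theorem theorem2p6 (G : groupType) (H : set G) :
  locally_nilpotent [set: G] ->
  subgroup H -> H <> [set 1] -> hypercentral H ->
  hereditary_aut_basis H [set: G] ->
  [/\ hypercentral [set: G],
      exists a, hypercentral_length H a /\ hypercentral_length [set: G] a
    & nilpotent_subgroup H -> nilpotent_subgroup [set: G]].
Proof.
move=> lnG sgH HN1 [a ZHa] herH.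
have up b : upper_central H b = H -> upper_central [set: G] b = [set: G].
  exact: upper_central_full.
have down b : upper_central [set: G] b = [set: G] -> upper_central H b = H.
  move=> ZG; apply/seteqP; split; first exact: upper_central_sub.
  by move=> h Hh; apply: (@upper_central_restrict _ H [set: G]) => //; rewrite ZG.
split; first by exists a; apply: up.
- have [m [ZHm m_min]] := ord_minimum (P := fun b => upper_central H b = H) ZHa.
  exists m; split; split=> //; first exact: up.
  by move=> b /down; apply: m_min.
- move=> [n]; rewrite -iter_upper_central => /up ZG.
  by exists n; rewrite -iter_upper_central.
Qed.
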